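(* Let $a$ be a primitive element of $\mathbb{F}_{2^6}$, identify $\mathbb{F}_2^6$ with $\mathbb{F}_{2^6}$, and let $\Gamma_{21}$ be the group generated by the $\mathbb{F}_2$-linear map $x\mapsto a^{21}x$, acting on the $3$-dimensional subspaces of $\mathbb{F}_2^6$. For every $\gamma_1\in\{12,15,18,24,27,30\}$ there exists a completely regular code $C$ in the Grassmann graph $J_2(6,3)$ with covering radius $1$ and intersection array $\{93-\gamma_1;\gamma_1\}$ that is invariant under $\Gamma_{21}$.
   Context: The Grassmann graph $J_2(6,3)$ has as vertices the $3$-dimensional subspaces of $\mathbb{F}_2^6$, adjacent iff they meet in a $2$-dimensional subspace; it is $98$-regular. A vertex set $C$ is a completely regular code with covering radius $1$ and intersection array $\{\beta_0;\gamma_1\}$ if $C$ and its complement are nonempty, every vertex of $C$ has exactly $\beta_0$ neighbours outside $C$, and every vertex outside $C$ has exactly $\gamma_1$ neighbours in $C$. $C$ is invariant under $\Gamma_{21}$ if the image of every element of $C$ under every element of $\Gamma_{21}$ lies in $C$. *)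

(* Defs.v *)
From HB Require Import structures.
From mathcomp Require Import all_boot all_order all_algebra all_field.
Set Implicit Arguments. Unset Strict Implicit. Unset Printing Implicit Defensive.
Import GRing.Theory.
Local Open Scope ring_scope.

Notation F2space F chF := (@pPrimeCharType 2 F chF).

(* {vspace V} is a subtype of a matrix type over the finite field 'F_2,
   hence a finite type; we make this explicit so that we can form sets of
   subspaces and count them. *)
Module FinVspace.
Import VectorInternalTheory.
HB.instance Definition _ (K : finFieldType) (W : vectType K) :=
  [Finite of {vspace W} by <:].
End FinVspace.
Export FinVspace.

Section Grassmann.
Variables (F : finFieldType) (chF : 2 \in [pchar F]).
Local Notation V := (F2space F chF).

Definition grass_vertex (U : {vspace V}) : bool := \dim U == 3%N.

Definition grass_adj (U W : {vspace V}) : bool :=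
  [&& grass_vertex U, grass_vertex W & \dim (U :&: W) == 2%N].

Definition crc_radius1 (C : {set {vspace V}}) (beta0 gamma1 : nat) : Prop :=
  [/\ (forall U, U \in C -> grass_vertex U),
      (exists U, U \in C),
      (exists U, grass_vertex U /\ U \notin C),
      (forall U, U \in C ->
         #|[set W | grass_adj U W & W \notin C]| = beta0) &
      (forall U, grass_vertex U -> U \notin C ->
         #|[set W | grass_adj U W & W \in C]| = gamma1)].

(* Gamma_21 = < x |-> a^21 x >; its elements are the maps x |-> a^(21 k) x,
   k : nat (the group is finite, so nonnegative powers exhaust it).
   C is invariant if the image of each member of C under each element of
   Gamma_21 lies in C. *)
Definition gamma21_invariant (a : V) (C : {set {vspace V}}) : Prop :=
  forall (k : nat) (U : {vspace V}), U \in C ->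
    (amull (a ^+ (21 * k)) @: U)%VS \in C.

End Grassmann.

(* Main.v *)
From Stdlib Require Import BinPosDef.
Require Import Defs.
From HB Require Import structures.
From mathcomp Require Import all_boot all_order all_algebra all_field.
Import GRing.Theory.

(** The map x |-> a^21 x is multiplication by a primitive cube root of unity w,
    so an F_4-basis (e, f, g) of the field yields the F_2-basis
    (e, w e, f, w f, g, w g), in which the map has a fixed matrix whatever the
    primitive element a is. The six codes can therefore be given once and for
    all as explicit lists of subspaces of F_2^6, found by computer search.

    Adjacency counts reduce to counts of pairs: if k is the number of nonzero
    vectors in U :&: W, with dim U = dim W = 3, then k (k - 1) is 6 if U and W
    are adjacent, 42 if U = W, and 0 otherwise. Summed over W in C, this
    determines the number of neighbours of U in C from the numbers of members
    of C through pairs of vectors of U, and these are tabulated once per code. *)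

(** * Subspaces of F_2^6 as bit lists, and the six codes *)

(* Vectors of F_2^n are bit lists; the coordinates 2i and 2i+1 belong to the
   basis vectors b and w b of the F_4-line spanned by b, and [vomega] is
   multiplication by w, as w^2 = w + 1. *)
Fixpoint vadd (u v : bitseq) : bitseq :=
  match u, v with
  | a :: u', b :: v' => xorb a b :: vadd u' v'
  | _, _ => [::]
  end.

Fixpoint vomega (v : bitseq) : bitseq :=
  if v is a :: b :: v' then b :: xorb a b :: vomega v' else [::].

(** Strict lexicographic order on words of equal length, with [false] below [true]. *)
Fixpoint vlt (u v : bitseq) : bool :=
  match u, v with
  | a :: u', b :: v' => if a then b && vlt u' v' else b || vlt u' v'
  | _, _ => false
  end.

Fixpoint words (n : nat) : seq bitseq :=
  if n is n'.+1 then map (cons false) (words n') ++ map (cons true) (words n')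
  else [:: [::]].

Definition vzero : bitseq := nseq 6 false.

Definition plane (x y z : bitseq) : seq bitseq :=
  let s := vadd x y in [:: x; y; s; z; vadd x z; vadd y z; vadd s z].

(* A subspace is represented by the list of its nonzero vectors. Each
   3-dimensional subspace is listed once, through its greedy basis: x is its
   least nonzero vector, y the least outside <x>, z the least outside <x, y>. *)
Definition planes : seq (seq bitseq) :=
  (* The first word is the zero vector. *)
  let V := behead (words 6) in
  flatten [seq
    flatten [seq
      [seq plane x y z | z <- V
        & [&& vlt y z, vlt z (vadd x z), vlt z (vadd y z)
            & vlt z (vadd (vadd x y) z)]]
    | y <- V & vlt x y && vlt y (vadd x y)]
  | x <- V].

(* Least significant bit first; the leading 1 only marks the end. *)
Fixpoint bits (p : positive) : bitseq :=
  match p with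
  | xI p' => true :: bits p'
  | xO p' => false :: bits p'
  | xH => [::]
  end.

(** The [i]-th lowest bit of the numeral tells whether the [i]-th entry of [planes] belongs to the
    code. *)
Definition code_mask (gamma1 : nat) : bitseq :=
  bits match gamma1 with
  | 12 =>
    0x800000001020084000904d4080018200820a401c8102820001561108010300008180010401104ac120104008000000000302040012080251828400009b400880a000102824204e00891000000000001008486508020c00000000040c0102008400000000000142000000104000600140442c800000220800040000100000a00000024114200020a40000200001001000020220800000124412200000040008010020002410000c400000010492147%positive
  | 15 =>
    0xc224008804020900201240000c009220020a0a08080a000800168000003b8000758000000000588000908000809090900112400c000092012200081002400891008001422410420109010421401404102140c020000c00020a01200c007200000000005f240000210110c4400444040044040c42042008004060200060406040100891102142220880200001fd4800000000a20a00901094100850181040000181020604142140c00a00904420000%positive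
  | 18 =>
    0x850910801824002080124821600c42000220001418840a20c2006209e019e2189820802400140a02e00940804824001099020c21200412006019e218c2006209860900412824420020000077710001920900000c0340deb81000001011a04114400400208003de8020040619a609a4002618a0004000400000006021184801908004000001000007001000024600c1804818000400000400006041288040601018010180000100000400060115ebf%positive
  | 24 =>
    0xa40b11c209045210e0922c21010c32408a20c11441140a46b1450008b15444088a00d11441160b20840930c229246210c0920c47210c1240b1544408b1450008a40812c2093462108800007ffc0040120ca1218c12c0fff8080000080a20c17241140a208007ff8010009345440893540008880020000bde82066160581811818002000000800006801840662601a180381800020000020000602186536060181801818000008000020006009ffff%positive
  | 27 =>
    0x81891040097702104081882020043ec0cf2bc11841140b28d5cee008d144a208cba0c19471c44a20a00918924b040288409024614005024c914da209914c0a39c00352820a2602108081207ff82250924471e10c125aebda004020009004d50441040e240417ffc4001051441259f54422188041010803de8504e660100841c010108158040040848410e1078600808088904082111010803861000204606040df010100380408210201120437fff%positive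
  | 30 =>
    0xa419b0d209245214e1922c31232c12408aa48195ed940800934523818140225b9a08c014491c887aa60936c209264250c0960c37290c1640c16422087d406348b40910c6093d6210a00802777400407b1d29010c1141fff8108400904a20c116411c6aa09005eb801084107ce2a891c0a200a0802000c7ff860660601c1c1d8384004005f0208016005a7a660601a1c0181900100002004703e2098707606198180991bf02080100104007001ebdf%positive
  | _ => xH
  end.

(** * Multisets of vector tuples and the decidable checks *)

(* A multiset of bit lists: the node reached along k holds the multiplicity of k. *)
Inductive trie := Nil | Node of nat & trie & trie.

Fixpoint incr (k : bitseq) (t : trie) : trie :=
  match k, t with
  | [::], Nil => Node 1 Nil Nil
  | [::], Node n l r => Node n.+1 l r
  | true :: k', Nil => Node 0 Nil (incr k' Nil)
  | false :: k', Nil => Node 0 (incr k' Nil) Nil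
  | true :: k', Node n l r => Node n l (incr k' r)
  | false :: k', Node n l r => Node n (incr k' l) r
  end.

Fixpoint get (t : trie) (k : bitseq) : nat :=
  match t, k with
  | Nil, _ => 0
  | Node n _ _, [::] => n
  | Node _ l r, b :: k' => get (if b then r else l) k'
  end.

Definition tally (ks : seq bitseq) : trie := foldr incr Nil ks.

Definition pairs (w : seq bitseq) := [seq u ++ v | u <- w, v <- w].
Definition triples (w : seq bitseq) := [seq p ++ v | p <- pairs w, v <- w].

(** Together with zero, eight distinct vectors closed under addition: a 3-dimensional subspace. *)
Definition wf_plane (w : seq bitseq) :=
  [&& size w == 7, uniq (vzero :: w), all (fun u => size u == 6) w
    & all (fun u => all (fun v => vadd u v \in vzero :: w) w) w].

(** With [t] the tally of the pairs of a family [T], this is the sum of [k (k - 1)] over [s] in [T],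
    where [k] counts the nonzero vectors common to [s] and [w]. *)
Definition incidences (t : trie) (w : seq bitseq) : nat :=
  sumn [seq sumn [seq get t (u ++ v) | v <- w & u != v] | u <- w].

Definition incidences_are (T P : seq (seq bitseq)) (n : nat) : bool :=
  let t := tally (flatten (map pairs T)) in
  all (fun w => incidences t w == n) P.

(** Only inclusion of the image in a member of [T] is tested; equality follows by comparing
    dimensions. *)
Definition omega_closed (T : seq (seq bitseq)) : bool :=
  let Q := map tally T in
  all (fun s => let s' := map vomega s in
    has (fun t => all (fun u => 0 < get t u) s') Q) T.

(* Every linearly independent triple (u, v, x) lies in exactly one member of P;
   this makes P a complete list, without repetition, of the 3-dimensional
   subspaces. *)
Definition is_design (P : seq (seq bitseq)) : bool :=
  let t := tally (flatten (map triples P)) in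
  let V := words 6 in
  all (fun u => all (fun v => all (fun x =>
    uniq [:: vzero; u; v; vadd u v; x] ==> (get t ((u ++ v) ++ x) == 1)) V) V) V.

Definition code (g : nat) := mask (code_mask g) planes.
Definition cocode (g : nat) := mask (map negb (code_mask g)) planes.

(* 93 - g of the 98 neighbours of a member lie outside the code, so g + 5 lie
   inside. *)
Definition code_check (g : nat) : bool :=
  [&& size (code_mask g) == size planes,
      incidences_are (code g) (code g) (42 + 6 * (g + 5)),
      incidences_are (code g) (cocode g) (6 * g),
      omega_closed (code g), code g != [::] & cocode g != [::]].

(** * Verification by computation *)

Lemma planes_wf : all wf_plane planes.
Proof. by vm_compute. Qed.

Lemma planes_design : is_design planes.
Proof. by vm_compute. Qed.

(** Here 630 = 42 + 6 * 98: a subspace contributes 42 for itself and 6 for each of its 98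
    neighbours. *)
Lemma planes_regular : incidences_are planes planes 630.
Proof. by vm_compute. Qed.

Lemma code_ok : all code_check [:: 12; 15; 18; 24; 27; 30].
Proof. by vm_compute. Qed.

(** * Meaning of the tallies: double counting of pairs *)

Lemma get_incr k k' t : get (incr k t) k' = (k == k') + get t k'.
Proof.
elim: k k' t => [|b k IHk] k' t; first by case: t => [|n l r]; case: k' => [|[] []].
by case: b; case: t => [|n l r]; case: k' => [|[] k'] //=; rewrite IHk eqseq_cons.
Qed.

Lemma get_tally ks k : get (tally ks) k = count_mem k ks.
Proof. by elim: ks => //= k' ks IHks; rewrite get_incr IHks. Qed.

(** Equal lengths in the first factor make the splitting of a concatenation unique, so
    multiplicities multiply. *)
Lemma count_mem_cat_pairs (A B : seq bitseq) u v :
  all (fun x => size x == size u) A ->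
  count_mem (u ++ v) [seq x ++ y | x <- A, y <- B] = count_mem u A * count_mem v B.
Proof.
elim: A => //= x A IHA /andP[/eqP szx szA]; rewrite count_cat IHA // mulnDl.
congr (_ + _); rewrite count_map -[RHS]/(nat_of_bool _ * _).
rewrite (eq_count (a2 := fun y => (x == u) && (y == v))); last first.
  by move=> y /=; rewrite eqseq_cat.
by case: (x == u); rewrite ?mul1n // mul0n; elim: (B) => //=.
Qed.

Lemma count_mem_flatten (ss : seq (seq bitseq)) k :
  count_mem k (flatten ss) = \sum_(s <- ss) count_mem k s.
Proof. by rewrite count_flatten sumnE big_map. Qed.

Definition uniform (w : seq bitseq) := uniq w && all (fun u => size u == 6) w.

Lemma count_mem_pairs w u v : uniform w -> size u = 6 ->
  count_mem (u ++ v) (pairs w) = (u \in w) && (v \in w).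
Proof.
move=> /andP[Uw szw] szu; rewrite count_mem_cat_pairs ?szu //.
by rewrite !count_uniq_mem // mulnb.
Qed.

Lemma count_mem_triples w u v x : uniform w -> size u = 6 -> size v = 6 ->
  count_mem ((u ++ v) ++ x) (triples w) = [&& u \in w, v \in w & x \in w].
Proof.
move=> ufw szu szv; have /andP[Uw /allP szw] := ufw.
rewrite count_mem_cat_pairs ?count_mem_pairs // ?count_uniq_mem ?mulnb ?andbA //.
apply/allP=> _ /allpairsP[[y z] [/= /szw/eqP szy /szw/eqP szz ->]].
by rewrite !size_cat szy szz szu szv.
Qed.

Lemma sum_offdiag (w s : seq bitseq) : uniq w ->
  \sum_(u <- w) \sum_(v <- w | u != v) ((u \in s) && (v \in s))
    = count (mem s) w * (count (mem s) w).-1.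
Proof.
move=> Uw; set k := count _ w.
have kE : k = \sum_(v <- w) (v \in s).
  by rewrite /k -sum1_count big_mkcond; apply: eq_bigr => v _ /=; case: (v \in s).
have inner u : u \in w ->
    \sum_(v <- w | u != v) ((u \in s) && (v \in s)) = (u \in s) * k.-1.
  move=> uw; case us: (u \in s); last by rewrite mul0n big1.
  by rewrite mul1n kE [in RHS](bigD1_seq u) //= us; apply: eq_bigl => v; rewrite eq_sym.
by rewrite big_seq (eq_bigr _ inner) -big_seq -big_distrl /= -kE.
Qed.

(** Double counting: the sum over pairs of vectors of [w] is exchanged with the sum over the members
    of [T]. *)
Lemma incidencesE (T : seq (seq bitseq)) w : all uniform T -> uniform w ->
  incidences (tally (flatten (map pairs T))) w
    = \sum_(s <- T) count (mem s) w * (count (mem s) w).-1.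
Proof.
move=> /allP ufT /andP[Uw /allP szw]; rewrite /incidences sumnE big_map.
transitivity (\sum_(u <- w) \sum_(v <- w | u != v) \sum_(s <- T)
                ((u \in s) && (v \in s))).
  apply: eq_big_seq => u /szw/eqP szu; rewrite sumnE big_map big_filter.
  apply: eq_bigr => v _; rewrite get_tally count_mem_flatten big_map.
  by apply: eq_big_seq => s /ufT ufs; rewrite count_mem_pairs.
under eq_bigr do rewrite exchange_big.
by rewrite exchange_big; apply: eq_bigr => s _; rewrite sum_offdiag.
Qed.

Local Open Scope ring_scope.

(** * Coordinates of the field with respect to an F_4-basis *)

Lemma size_vadd u v : size u = size v -> size (vadd u v) = size u.
Proof. by elim: u v => [|a u IHu] [|b v] //= [/IHu->]. Qed.

Lemma vadd_eq0 u v n : size u = n -> size v = n -> vadd u v = nseq n false -> u = v.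
Proof.
by elim: n u v => [|n IHn] [|[] u] [|[] v] //= [szu] [szv] [/(IHn _ _ szu szv)->].
Qed.

Lemma size_vomega v n : size v = n.*2 -> size (vomega v) = n.*2.
Proof. by elim: n v => [|n IHn] [|a [|b v]] //= [/IHn->]. Qed.

Section Coordinates.
Variables (F : finFieldType) (chF : (2 \in [pchar F])%N).
Implicit Types (es bs : seq F) (w x : F) (u v : bitseq).

Fixpoint decode es v : F :=
  match es, v with
  | e :: es', b :: v' => (if b then e else 0) + decode es' v'
  | _, _ => 0
  end.

Lemma decode_vadd es u v : size u = size es -> size v = size es ->
  decode es (vadd u v) = decode es u + decode es v.
Proof.
elim: es u v => [|e es IHes] [|a u] [|b v] //=; rewrite ?addr0 // => -[szu] [szv].
rewrite IHes // addrACA; congr (_ + _).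
by case: a; case: b; rewrite /= ?(addrr_pchar2 chF) ?add0r ?addr0.
Qed.

Lemma decode_nseq0 es n : decode es (nseq n false) = 0.
Proof. by elim: es n => [|e es IHes] [|n] //=; rewrite add0r. Qed.

Definition f4_frame w bs := flatten [seq [:: b; w * b] | b <- bs].

Lemma size_f4_frame w bs : size (f4_frame w bs) = (size bs).*2.
Proof. by elim: bs => //= b bs ->. Qed.

(** On each F_4-line, [w (c b + d w b) = d b + (c + d) w b], because [w^2 = w + 1]. *)
Lemma decode_vomega w bs v : w ^+ 2 = w + 1 -> size v = (size bs).*2 ->
  decode (f4_frame w bs) (vomega v) = w * decode (f4_frame w bs) v.
Proof.
move=> w2; elim: bs v => [|b bs IHbs] [|c [|d v]] //=; rewrite ?mulr0 // => -[szv].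
rewrite -/(f4_frame w bs) IHbs // !mulrDr !addrA; congr (_ + _).
have w2b : w * (w * b) = w * b + b by rewrite mulrA -expr2 w2 mulrDl mul1r.
case: c; case: d; rewrite /= ?mulr0 ?addr0 ?add0r ?w2b //; last exact: addrC.
by rewrite addrA (addrr_pchar2 chF) add0r.
Qed.

(** Linear independence of [es] over F_2. *)
Definition faithful es :=
  forall v, size v = size es -> decode es v = 0 -> v = nseq (size es) false.

Lemma decode_inj es u v : faithful es -> size u = size es -> size v = size es ->
  decode es u = decode es v -> u = v.
Proof.
move=> es0 szu szv eq_uv; apply: (@vadd_eq0 _ _ (size es)) => //; apply: es0.
  by rewrite size_vadd szu.
by rewrite decode_vadd // eq_uv (addrr_pchar2 chF).
Qed.

(** Greedy extension: while the F_4-span is smaller than the field, any [b] outside it can be added.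
    A relation putting [(c + d w) b] in the span would, after division by the nonzero scalar
    [c + d w], put [b] there. *)
Lemma f4_frame_exists w n : w ^+ 2 = w + 1 -> (4 ^ n <= #|F|)%N ->
  exists2 bs, size bs = n & faithful (f4_frame w bs).
Proof.
move=> w2; elim: n => [|n IHn] cardF.
  by exists [::] => // v /size0nil->.
have cardF' : (4 ^ n < #|F|)%N by apply: leq_trans cardF; rewrite ltn_exp2l.
have [bs szbs faith_bs] := IHn (ltnW cardF').
pose D (t : (n.*2).-tuple bool) := decode (f4_frame w bs) t.
(* Pigeonhole: there are only [4 ^ n] words to decode. *)
have [b notDb] : exists b, b \notin codom D.
  apply/existsP; rewrite -negb_forall; apply: contraL cardF' => /forallP allD.
  rewrite -leqNgt -(_ : #|{: (n.*2).-tuple bool}| = (4 ^ n)%N); last first.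
    by rewrite card_tuple card_bool -mul2n expnM.
  have /subset_leq_card/leq_trans : F \subset codom D by apply/subsetP.
  by apply; apply: leq_image_card.
have notD v : size v = n.*2 -> decode (f4_frame w bs) v != b.
  move=> /eqP szv; apply: contraNneq notDb => <-.
  by rewrite (_ : decode _ v = D (Tuple szv)) ?codom_f.
exists (b :: bs) => [|v]; first by rewrite /= szbs.
rewrite size_f4_frame /= szbs -/(f4_frame w bs).
case: v => [|c [|d v]] //= [szv]; rewrite addrA => /eqP; rewrite addr_eq0.
rewrite (oppr_pchar2 chF) => /eqP eq_v.
have szv' := size_vomega _ _ szv.
have sc v1 : size v1 = n.*2 ->
    w * decode (f4_frame w bs) v1 = decode (f4_frame w bs) (vomega v1).
  by move=> sz1; rewrite decode_vomega // szbs.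
have w2y y : w * (w * y) = y + w * y by rewrite mulrA -expr2 w2 mulrDl mul1r addrC.
have w3y y : w * (w * (w * y)) = y.
  by rewrite w2y w2y addrCA (addrr_pchar2 chF) addr0.
(* The scalars [1 + w], [1] and [w] are inverted by [w], [1] and [w^2]; in the last case the scalar
   is 0 and independence of the old frame applies. *)
case: c d eq_v => [] [] /= eq_v.
- have /eqP[] := notD (vomega v) szv'.
  by rewrite -sc // -eq_v -w2y w3y.
- by have /eqP[] := notD v szv; rewrite -eq_v addr0.
- have /eqP[] := notD (vomega (vomega v)) (size_vomega _ _ szv').
  by rewrite -!sc // -eq_v add0r w3y.
- by rewrite addr0 in eq_v; rewrite (faith_bs v) ?size_f4_frame ?szbs.
Qed.

(** An injection between finite sets of equal size is onto. *)
Lemma decode_surj es x : faithful es -> (2 ^ size es)%N = #|F| ->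
  exists2 v, size v = size es & x = decode es v.
Proof.
move=> es_inj card_es; pose D (t : (size es).-tuple bool) := decode es t.
have injD : injective D.
  by move=> s t /decode_inj eq_st; apply/val_inj/eq_st; rewrite ?size_tuple.
have /codomP[t ->] : x \in codom D.
  by apply: inj_card_onto; rewrite // card_tuple card_bool card_es.
by exists t; rewrite ?size_tuple.
Qed.

End Coordinates.

(** * From lists of vectors to 3-dimensional subspaces *)

Lemma wf_planeP w : wf_plane w ->
  [/\ size w = 7%N, uniq (vzero :: w), (forall u, u \in vzero :: w -> size u = 6%N)
    & forall u v, u \in vzero :: w -> v \in vzero :: w -> vadd u v \in vzero :: w].
Proof.
case/and4P=> /eqP sz7 Uw /allP sz6 /allP closed.
have sz u : u \in vzero :: w -> size u = 6%N.
  by rewrite inE => /predU1P[-> // | /sz6/eqP].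
have add0v n u : size u = n -> vadd (nseq n false) u = u.
  by elim: n u => [|n IHn] [|[] u] //= [/IHn->].
have addv0 n u : size u = n -> vadd u (nseq n false) = u.
  by elim: n u => [|n IHn] [|[] u] //= [/IHn->].
split=> // u v; rewrite [u \in _]inE => /predU1P[-> vw | uw].
  by rewrite (add0v 6) ?sz.
rewrite [v \in _]inE => /predU1P[-> | vw].
  by rewrite (addv0 6) ?sz // inE uw orbT.
by have /allP := closed u uw; apply.
Qed.

Lemma wf_plane_uniform w : wf_plane w -> uniform w.
Proof. by case/and4P=> _ /= /andP[_ Uw] sz6 _; rewrite /uniform Uw. Qed.

Lemma perm_mask_negb (S : eqType) (m : bitseq) (s : seq S) : size m = size s ->
  perm_eq (mask m s ++ mask (map negb m) s) s.
Proof.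
elim: m s => [|[] m IHm] [|x s] //= [/IHm IHs]; first by rewrite perm_cons.
by rewrite perm_catC /= perm_cons perm_catC.
Qed.

Section Planes.
Variables (F : finFieldType) (chF : (2 \in [pchar F])%N).
Local Notation V := (F2space F chF).

Lemma F2_cases (b : 'F_2) : b = 0 \/ b = 1.
Proof. by case: b => [[|[|]]] //= i; [left | right]; apply: val_inj. Qed.

(** Over F_2 the only coefficients are 0 and 1, so a linear combination is a sum of members. *)
Lemma mem_span_closed (X : seq V) :
  0 \in X -> {in X &, forall x y, x + y \in X} -> <<X>>%VS =i X.
Proof.
move=> X0 addX x; apply/idP/idP=> [|xX]; last exact: memv_span.
move/(coord_span (X := in_tuple X))=> ->.
apply: (big_ind (fun y => y \in X)) => //= i _.
by case: (F2_cases (coord (in_tuple X) i x)) => ->; rewrite ?scale0r ?scale1r // mem_nth.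
Qed.

(* [P] stands for [planes], kept abstract so that unification cannot start
   evaluating it. *)
Variable P : seq (seq bitseq).
Hypotheses (wf_P : all wf_plane P) (design_P : is_design P).

Variable es : seq F.
Hypotheses (size_es : size es = 6%N) (faith_es : faithful F es).
Hypothesis card_F : #|F| = (2 ^ 6)%N.
Local Notation dec := (fun u => decode F es u : V).

Definition span_plane (w : seq bitseq) : {vspace V} := <<map dec (vzero :: w)>>%VS.
Local Notation sp := span_plane.

Lemma dec0 : dec vzero = 0. Proof. exact: decode_nseq0. Qed.

Lemma dec_inj u v : size u = 6%N -> size v = 6%N -> dec u = dec v -> u = v.
Proof. by move=> szu szv; apply: (decode_inj F chF es) => //; rewrite size_es. Qed.

Lemma dec_surj x : exists2 u, size u = 6%N & x = dec u.
Proof.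
have [|u szu ->] := decode_surj F chF es x faith_es; first by rewrite size_es card_F.
by exists u; rewrite ?szu.
Qed.

Lemma mem_span_plane w : wf_plane w -> sp w =i map dec (vzero :: w).
Proof.
move=> /wf_planeP[_ _ sz addw]; apply: mem_span_closed.
  by rewrite -dec0 map_f ?mem_head.
move=> _ _ /mapP[u uw ->] /mapP[v vw ->].
by rewrite -decode_vadd ?size_es ?sz // (map_f dec) ?addw.
Qed.

Lemma dec_in_plane w u : wf_plane w -> size u = 6%N ->
  (dec u \in sp w) = (u \in vzero :: w).
Proof.
move=> wf_w szu; rewrite mem_span_plane //; apply/mapP/idP=> [[v vw]|]; last by exists u.
by have [_ _ sz _] := wf_planeP _ wf_w; move=> /dec_inj-> //; apply: sz.
Qed.

(** Both sides count the vectors of the intersection; the successor accounts for zero. *)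
Lemma card_span_capv w t : wf_plane w -> wf_plane t ->
  (2 ^ \dim (sp w :&: sp t))%N = (count (mem t) w).+1.
Proof.
move=> wf_w wf_t; have [_ /= /andP[w0 Uw] szw _] := wf_planeP _ wf_w.
have [_ /= /andP[t0 _] _ _] := wf_planeP _ wf_t.
have -> : (count (mem t) w).+1 = size (map dec (vzero :: filter (mem t) w)).
  by rewrite size_map /= size_filter.
transitivity #|(sp w :&: sp t)%VS|; first by rewrite card_vspace card_Fp.
rewrite -(card_uniqP _); last first.
  rewrite map_inj_in_uniq /=; first by rewrite mem_filter negb_and w0 orbT filter_uniq.
  have sub u : u \in vzero :: filter (mem t) w -> size u = 6%N.
    rewrite inE mem_filter => /predU1P[-> // | /andP[_ uw]].
    by rewrite szw // inE uw orbT.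
  by move=> u v /sub szu /sub szv; apply: dec_inj.
apply: eq_card => x; rewrite memv_cap.
have [u szu ->] := dec_surj x; rewrite !dec_in_plane //.
apply/andP/mapP=> [[uw ut]|[v vwt /dec_inj->] //].
  exists u => //; rewrite inE mem_filter; move: uw ut; rewrite !inE.
  by case: eqP => //= _ uw ut; rewrite uw ut.
- move: vwt; rewrite !inE mem_filter.
  by case: eqP => //= _ /andP[vt vw]; rewrite vw vt.
move: vwt; rewrite inE mem_filter => /predU1P[-> // | /andP[_ vw]].
by rewrite szw // inE vw orbT.
Qed.

Lemma dim_span_plane w : wf_plane w -> \dim (sp w) = 3%N.
Proof.
move=> wf_w; have [sz7 _ _ _] := wf_planeP _ wf_w.
have := card_span_capv w w wf_w wf_w; rewrite capvv.
have /eqP-> : count (mem w) w == size w by rewrite -all_count; apply/allP.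
by rewrite sz7 => eq8; apply: (@expnI 2).
Qed.

Lemma exists_notin (U : {vspace V}) (s : seq V) :
  (size s < 2 ^ \dim U)%N -> exists2 x, x \in U & x \notin s.
Proof.
move=> lt_s; have /subsetPn[x xU xs] : ~~ (U \subset s).
  apply: contraL lt_s => /subset_leq_card; rewrite card_vspace card_Fp // => le_U.
  by rewrite -leqNgt (leq_trans le_U) ?card_size.
by exists x.
Qed.

(** Each new vector avoids the span of the previous ones, which has 1, 2, then 4 of the 8 vectors of
    [U]. The [uniq] condition expresses linear independence of the triple. *)
Lemma frame_of_plane (U : {vspace V}) : \dim U = 3%N ->
  exists u v t, [/\ [/\ size u = 6%N, size v = 6%N & size t = 6%N],
    [/\ dec u \in U, dec v \in U & dec t \in U]
    & uniq [:: vzero; u; v; vadd u v; t]].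
Proof.
move=> dimU.
have [|x xU x0] := exists_notin U [:: 0]; first by rewrite dimU.
have [|y yU y0] := exists_notin U [:: 0; x]; first by rewrite dimU.
have [|z zU z0] := exists_notin U [:: 0; x; y; x + y]; first by rewrite dimU.
have [u szu x_u] := dec_surj x; have [v szv y_v] := dec_surj y.
have [t szt z_t] := dec_surj z; exists u, v, t; split; rewrite -?x_u -?y_v -?z_t //.
apply: (map_uniq (f := dec)); rewrite /= decode_vadd ?size_es // decode_nseq0.
rewrite -x_u -y_v -z_t; move: x0 y0 z0; rewrite !inE !negb_or.
move=> x0 /andP[y0 yx] /and4P[z0 zx zy zxy].
rewrite ![0 == _]eq_sym x0 y0 z0 addr_eq0 (oppr_pchar2 chF) [x == y]eq_sym yx.
have -> : (x == x + y) = (y == 0) by rewrite -{1}[x]addr0 (inj_eq (addrI x)) eq_sym.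
have -> : (y == x + y) = (x == 0) by rewrite -{1}[y]add0r (inj_eq (addIr y)) eq_sym.
by rewrite x0 y0 ![_ == z]eq_sym zx zy zxy.
Qed.

Lemma count_frame u v t : size u = 6%N -> size v = 6%N -> size t = 6%N ->
  uniq [:: vzero; u; v; vadd u v; t] ->
  count (fun w => [&& u \in w, v \in w & t \in w]) P = 1%N.
Proof.
move=> szu szv szt Uuvt.
have wordsP n (x : bitseq) : size x = n -> x \in words n.
  elim: n x => [|n IHn] [|b x] //= [/IHn xn]; rewrite mem_cat.
  by case: b; rewrite map_f ?orbT.
have /allP/(_ u (wordsP _ _ szu))/allP/(_ v (wordsP _ _ szv)) := design_P.
move=> /allP/(_ t (wordsP _ _ szt)); rewrite Uuvt /= => /eqP<-.
rewrite get_tally count_mem_flatten big_map -sum1_count big_mkcond /=.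
apply: eq_big_seq => w /(allP wf_P)/wf_plane_uniform ufw.
by rewrite count_mem_triples //; case: and3P.
Qed.

Lemma frame_in_plane w u v t : wf_plane w ->
  size u = 6%N -> size v = 6%N -> size t = 6%N -> uniq [:: vzero; u; v; vadd u v; t] ->
  [/\ dec u \in sp w, dec v \in sp w & dec t \in sp w] ->
  [&& u \in w, v \in w & t \in w].
Proof.
move=> wf_w szu szv szt; rewrite !dec_in_plane // /= !inE !negb_or.
case/and5P=> /and4P[u0 v0 _ t0] _ _ _ _.
by rewrite ![_ == vzero]eq_sym (negPf u0) (negPf v0) (negPf t0) => -[/= -> -> ->].
Qed.

(** An independent triple of the common span lies in both lists, but in only one entry of [P]. *)
Lemma span_plane_inj : {in P &, injective sp}.
Proof.
move=> w w' wG w'G eq_ww'.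
have [wf_w wf_w'] := (allP wf_P _ wG, allP wf_P _ w'G).
have [u [v [t [[szu szv szt] uvt Uuvt]]]] := frame_of_plane _ (dim_span_plane _ wf_w).
have Pw := frame_in_plane _ _ _ _ wf_w szu szv szt Uuvt uvt.
rewrite eq_ww' in uvt.
have Pw' := frame_in_plane _ _ _ _ wf_w' szu szv szt Uuvt uvt.
have := count_frame _ _ _ szu szv szt Uuvt; rewrite -size_filter.
set s := filter _ _; have: w \in s /\ w' \in s by rewrite !mem_filter Pw Pw'.
by case: s => [|w0 [|]] //; rewrite !inE => -[/eqP-> /eqP->].
Qed.

(** Every copy of [w] in [P] contains the same independent triple, and only one entry does. *)
Lemma uniq_design : uniq P.
Proof.
apply: count_mem_uniq => w; case: (boolP (w \in P)) => wG; last exact/count_memPn.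
have wf_w := allP wf_P _ wG.
have [u [v [t [[szu szv szt] uvt Uuvt]]]] := frame_of_plane _ (dim_span_plane _ wf_w).
have Pw := frame_in_plane _ _ _ _ wf_w szu szv szt Uuvt uvt.
have le1 : (count_mem w P <= 1)%N.
  rewrite -(count_frame _ _ _ szu szv szt Uuvt).
  by apply: sub_count => _ /eqP->.
have gt0 : (0 < count_mem w P)%N by rewrite -has_count has_pred1.
by apply/eqP; rewrite eqn_leq le1 gt0.
Qed.

(** The entry [w] of [P] containing an independent triple of [U] spans [U], since both subspaces
    have dimension 3 and so does their intersection. *)
Lemma span_plane_surj (U : {vspace V}) : \dim U = 3%N -> exists2 w, w \in P & U = sp w.
Proof.
move=> dimU; have [u [v [t [[szu szv szt] [uU vU tU] Uuvt]]]] := frame_of_plane _ dimU.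
have : has (fun w => [&& u \in w, v \in w & t \in w]) P.
  by rewrite has_count count_frame.
case/hasP=> w wG /and3P[uw vw tw]; exists w => //.
have wf_w := allP wf_P _ wG.
have sub : {subset map dec [:: vzero; u; v; vadd u v; t] <= (U :&: sp w)%VS}.
  have [_ _ _ addw] := wf_planeP _ wf_w.
  have in0 y : y \in w -> y \in vzero :: w by rewrite inE => ->; rewrite orbT.
  move=> _ /mapP[x + ->]; rewrite memv_cap !inE.
  case/or4P=> [/eqP->|/eqP->|/eqP->|/orP[]/eqP->].
  - by rewrite dec0 !mem0v.
  - by rewrite uU dec_in_plane ?in0.
  - by rewrite vU dec_in_plane ?in0.
  - rewrite dec_in_plane ?size_vadd ?szu ?addw ?in0 //.
    by rewrite (decode_vadd F chF) ?size_es // memvD.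
  - by rewrite tU dec_in_plane ?in0.
have Udec : uniq (map dec [:: vzero; u; v; vadd u v; t]).
  rewrite map_inj_in_uniq // => x y xs ys; apply: dec_inj.
    by move: xs; rewrite !inE => /or4P[||| /orP[]] /eqP-> //; rewrite size_vadd ?szu.
  by move: ys; rewrite !inE => /or4P[||| /orP[]] /eqP-> //; rewrite size_vadd ?szu.
have dim_cap : \dim (U :&: sp w) = 3%N.
  (* Five known vectors already exceed the four of a 2-dimensional space. *)
  have le5 : (5 <= 2 ^ \dim (U :&: sp w))%N.
    have <- : #|(U :&: sp w)%VS| = (2 ^ \dim (U :&: sp w))%N by rewrite card_vspace card_Fp.
    rewrite -[5%N]/(size (map dec [:: vzero; u; v; vadd u v; t])) -(card_uniqP Udec).
    by apply/subset_leq_card/subsetP.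
  have := dimvS (capvSl U (sp w)); rewrite dimU; move: le5.
  by case: (\dim _) => [|[|[|[|]]]].
have /eqP <- : (U :&: sp w)%VS == U by rewrite eqEdim capvSl dim_cap dimU.
by apply/eqP; rewrite eqEdim capvSr dim_cap (dim_span_plane _ wf_w).
Qed.

(** * Neighbour counts and invariance for a family of planes *)

Definition span_set (T : seq (seq bitseq)) : {set {vspace V}} := [set U | U \in map sp T].

Variable T : seq (seq bitseq).
Hypotheses (uniqT : uniq T) (subT : {subset T <= P}).

Let sp_inj : {in P &, injective sp}.
Proof. exact: span_plane_inj. Qed.

Lemma mem_span_set w : w \in P -> (sp w \in span_set T) = (w \in T).
Proof.
move=> wG; rewrite inE; apply/mapP/idP=> [[t tT /sp_inj->] //|]; last by exists w.
exact: subT.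
Qed.

Lemma span_set_vertex U : U \in span_set T -> grass_vertex U.
Proof.
rewrite inE => /mapP[w /subT wG ->]; apply/eqP.
exact/dim_span_plane/(allP wf_P).
Qed.

(** With [k = 2^d - 1], intersection dimensions [d = 0, 1, 2, 3] give [k (k - 1) = 0, 0, 6, 42]. *)
Lemma count_capv_pairs w s : w \in P -> s \in P ->
  (count (mem s) w * (count (mem s) w).-1
    = 6 * grass_adj (sp w) (sp s) + 42 * (s == w))%N.
Proof.
move=> wG sG; have [wf_w wf_s] := (allP wf_P _ wG, allP wf_P _ sG).
have dimw : \dim (sp w) = 3%N by apply: dim_span_plane.
have dims : \dim (sp s) = 3%N by apply: dim_span_plane.
have -> : (s == w) = (\dim (sp w :&: sp s) == 3%N).
  apply/eqP/eqP=> [->|dim3]; first by rewrite capvv.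
  apply: sp_inj => //; apply/eqP.
  have /eqP <- : (sp w :&: sp s)%VS == sp s by rewrite eqEdim capvSr dim3 dims.
  by rewrite eqEdim capvSl dim3 dimw.
have := card_span_capv w s wf_w wf_s.
have := dimvS (capvSl (sp w) (sp s)).
rewrite /grass_adj /grass_vertex dimw dims /=.
by case: (\dim _) => [|[|[|[|//]]]] _ [<-].
Qed.

(** Summing the pair counts over [T]; since distinct entries span distinct subspaces, counting
    entries counts neighbours. *)
Lemma incidences_span w : w \in P ->
  (incidences (tally (flatten (map pairs T))) w
    = 6 * #|[set W | grass_adj (sp w) W & W \in span_set T]| + 42 * (w \in T))%N.
Proof.
move=> wG; rewrite incidencesE; last first.
- exact/wf_plane_uniform/(allP wf_P).
- by apply/allP=> s /subT sG; apply/wf_plane_uniform/(allP wf_P).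
have -> : #|[set W | grass_adj (sp w) W & W \in span_set T]|
    = count (fun s => grass_adj (sp w) (sp s)) T.
  rewrite -size_filter -(size_map sp) -(card_uniqP _); last first.
    rewrite map_inj_in_uniq ?filter_uniq // => s t.
    by rewrite !mem_filter => /andP[_ /subT sG] /andP[_ /subT tG]; apply: sp_inj.
  apply: eq_card => W; rewrite !inE; apply/andP/mapP=> [[adjW /mapP[s sT eqW]]|].
    by exists s => //; rewrite mem_filter sT -eqW adjW.
  by case=> s; rewrite mem_filter => /andP[adj_s sT] ->; split=> //; apply: map_f.
have countE p : count p T = (\sum_(s <- T) p s)%N by rewrite -sumn_count sumnE big_map.
rewrite -(count_uniq_mem _ uniqT) !countE.
rewrite [X in (X + _)%N]big_distrr [X in (_ + X)%N]big_distrr -big_split /=.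
by apply: eq_big_seq => s /subT sG; rewrite count_capv_pairs.
Qed.

Lemma span_set_invariant x : x != 0 ->
  (forall v, size v = 6%N -> dec (vomega v) = (x : V) * dec v) ->
  omega_closed T -> forall U, U \in span_set T ->
  (amull (x : V) @: U)%VS \in span_set T.
Proof.
move=> x0 dec_omega /allP closedT U; rewrite inE => /mapP[s sT ->].
have /= := closedT s sT; rewrite has_map => /hasP[t tT /allP/= st].
have [wf_s wf_t] := (allP wf_P _ (subT _ sT), allP wf_P _ (subT _ tT)).
have dims : \dim (sp s) = 3%N by apply: dim_span_plane.
have dimt : \dim (sp t) = 3%N by apply: dim_span_plane.
(* Inclusion suffices: multiplication by a nonzero [x] is injective, so the image also has dimension
   3. *)
rewrite inE; apply/mapP; exists t => //; apply/eqP; rewrite eqEdim.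
rewrite limg_dim_eq ?dims ?dimt; last first.
  by apply/eqP; rewrite -subv0 (eqP (lker0_amull _)) ?capvSr // unitfE.
rewrite andbT limg_span; apply/span_subvP=> _ /mapP[_ /mapP[u us ->] ->].
rewrite lfunE /=; have [_ _ szs _] := wf_planeP _ wf_s.
rewrite -dec_omega ?szs //; move: us; rewrite inE => /predU1P[->|us].
  by rewrite /= -/vzero dec0 mem0v.
have := st _ (map_f vomega us); rewrite get_tally -has_count has_pred1 => ut.
rewrite dec_in_plane // ?inE ?ut ?orbT //.
by rewrite (size_vomega _ 3) // szs // inE us orbT.
Qed.

End Planes.

(** * Complete regularity of the codes *)

Section Codes.
Variables (F : finFieldType) (chF : (2 \in [pchar F])%N).
Local Notation V := (F2space F chF).
Variable P : seq (seq bitseq).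
Hypotheses (wf_P : all wf_plane P) (design_P : is_design P).
Hypothesis regular_P : incidences_are P P 630%N.
Variable es : seq F.
Hypotheses (size_es : size es = 6%N) (faith_es : faithful F es).
Hypothesis card_F : #|F| = (2 ^ 6)%N.
Local Notation sp := (span_plane F chF es).
Local Notation span_set := (span_set F chF es).

Let uniq_P : uniq P.
Proof. exact: (uniq_design F chF P wf_P design_P es). Qed.

Let surj (U : {vspace V}) : grass_vertex U -> exists2 w, w \in P & U = sp w.
Proof. by move/eqP; apply: span_plane_surj. Qed.

(** As [P] lists all vertices, [6 n + 42 = 630] holds for the degree [n]. *)
Lemma grass_degree (U : {vspace V}) : grass_vertex U -> #|[set W | grass_adj U W]| = 98%N.
Proof.
case/surj=> w wG ->; have /allP/(_ w wG)/eqP := regular_P.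
rewrite (incidences_span F chF P wf_P design_P es) // wG muln1.
have -> : [set W | grass_adj (sp w) W & W \in span_set P]
        = [set W | grass_adj (sp w) W].
  apply/setP=> W; rewrite !inE andb_idr // => /and3P[_ /surj[t tG ->] _].
  exact: map_f.
move: #|_| => n; rewrite -[630%N]/(6 * 98 + 42)%N => /addIn/eqP.
by rewrite eqn_pmul2l // => /eqP.
Qed.

Variables (T T' : seq (seq bitseq)) (g : nat).
Hypotheses (permT : perm_eq (T ++ T') P) (T_nil : T != [::]) (T'_nil : T' != [::]).
Hypotheses (incT : incidences_are T T (42 + 6 * (g + 5))%N)
  (incT' : incidences_are T T' (6 * g)%N).

(** For members, [6 n + 42 = 42 + 6 (g + 5)] gives [g + 5] neighbours inside, and the degree gives
    the rest; for nonmembers, [6 n = 6 g]. *)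
Lemma span_set_crc : crc_radius1 (span_set T) (93 - g) g.
Proof.
have memG w : (w \in P) = (w \in T) || (w \in T').
  by rewrite -(perm_mem permT) mem_cat.
have [uniqT disj _] : [/\ uniq T, ~~ has (mem T) T' & uniq T'].
  by apply/and3P; rewrite -cat_uniq (perm_uniq permT).
have subT : {subset T <= P} by move=> w wT; rewrite memG wT.
have inC w : w \in P -> (sp w \in span_set T) = (w \in T).
  exact: (mem_span_set F chF P wf_P design_P es).
have vertex U : U \in span_set T -> grass_vertex U.
  exact: (span_set_vertex F chF P wf_P es).
have spV w : w \in P -> grass_vertex (sp w).
  by move=> wG; apply/eqP/dim_span_plane/(allP wf_P).
have nbrs w : w \in P ->
    (6 * #|[set W | grass_adj (sp w) W & W \in span_set T]| + 42 * (w \in T)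
      = if w \in T then 42 + 6 * (g + 5) else 6 * g)%N.
  move=> wG; rewrite -(incidences_span F chF P wf_P design_P es) //.
  move: wG; rewrite memG; case: ifP => [wT _ | _ /= wT'].
    by have /allP/(_ w wT)/eqP := incT.
  by have /allP/(_ w wT')/eqP := incT'.
split=> //.
- case: (T) T_nil subT inC => // w s _ sub inC; exists (sp w).
  by rewrite inC ?sub ?mem_head.
- case: (T') T'_nil disj memG => // w s _ /=; rewrite negb_or => /andP[wT _] memG.
  by have wG : w \in P; [rewrite memG mem_head orbT | exists (sp w); rewrite inC ?spV].
- move=> U UC; have /surj[w wG eqU] := vertex U UC; rewrite eqU inC // in UC.
  have := nbrs w wG; rewrite UC muln1 addnC => /addnI/eqP.
  rewrite eqn_pmul2l // => /eqP card_in.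
  have := grass_degree U (vertex U _); rewrite eqU inC // => /(_ UC).
  rewrite -(cardsID (span_set T)).
  have -> : [set W | grass_adj (sp w) W] :&: span_set T
      = [set W | grass_adj (sp w) W & W \in span_set T].
    by apply/setP=> W; rewrite !in_set.
  have -> : [set W | grass_adj (sp w) W] :\: span_set T
      = [set W | grass_adj (sp w) W & W \notin span_set T].
    by apply/setP=> W; rewrite in_setD in_set [RHS]in_set andbC.
  rewrite card_in => eq98.
  (* The 98 neighbours are the [g + 5] inside plus those outside, and [93 - g] is [98 - (g + 5)]. *)
  by rewrite -[93%N]/(98 - 5)%N -eq98 -subnDA [(5 + g)%N]addnC addKn.
move=> U /surj[w wG ->]; rewrite inC // => wT.
have := nbrs w wG; rewrite (negPf wT) muln0 addn0 => /eqP.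
by rewrite eqn_pmul2l // => /eqP.
Qed.

End Codes.

(** * The cube root of unity and the assembly of the proof *)

(** The element [w = a^21] satisfies [w^3 = a^63 = 1] but [w] is not 1, so the cofactor
    [w^2 + w + 1] of [w^3 - 1] vanishes. *)
Lemma pow21_sqr (F : finFieldType) (chF : (2 \in [pchar F])%N) (a : F) :
  (2 ^ 6 - 1)%N.-primitive_root a -> (a ^+ 21) ^+ 2 = a ^+ 21 + 1.
Proof.
move=> prim_a; set w := a ^+ 21.
have w1 : w - 1 != 0 by rewrite subr_eq0 -(prim_order_dvd prim_a).
have w3 : w ^+ 3 - 1 = 0 by rewrite -exprM (prim_expr_order prim_a) subrr.
have /esym/eqP := subrX1 w 3; rewrite w3 !big_ord_recr big_ord0 /= add0r expr0 expr1.
by rewrite mulf_eq0 (negPf w1) addr_eq0 (oppr_pchar2 chF) addrC => /eqP <-.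
Qed.

Theorem theorem7p1 (F : finFieldType) (chF : (2 \in [pchar F])%N)
    (cardF : #|F| = (2 ^ 6)%N)
    (a : F) (prim_a : (2 ^ 6 - 1)%N.-primitive_root a)
    (gamma1 : nat) (hg : gamma1 \in [:: 12; 15; 18; 24; 27; 30]%N) :
  exists C : {set {vspace F2space F chF}},
    crc_radius1 C (93 - gamma1) gamma1 /\
    gamma21_invariant (a : F2space F chF) C.
Proof.
set w := a ^+ 21; have w2 : w ^+ 2 = w + 1 by apply: pow21_sqr.
(* The field has dimension 3 over F_4, as [4^3 = 2^6]. *)
have [|bs sz_bs faith] := f4_frame_exists F chF w 3 w2; first by rewrite cardF.
have sz_es : size (f4_frame F w bs) = 6%N by rewrite size_f4_frame sz_bs.
have /and5P[/eqP sz_m incT incT' closedT /andP[T0 T'0]] := allP code_ok _ hg.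
have permT : perm_eq (code gamma1 ++ cocode gamma1) planes by apply: perm_mask_negb.
move: permT planes_wf planes_design planes_regular incT incT' closedT T0 T'0.
(* The concrete lists become variables, so that conversion cannot evaluate them. *)
move: planes (code gamma1) (cocode gamma1) => P T T'.
move=> permT wf design reg incT incT' closedT T0 T'0.
have uniqP : uniq P by apply: (uniq_design F chF P wf design (f4_frame F w bs)).
exists (span_set F chF (f4_frame F w bs) T); split.
  exact: (span_set_crc F chF P wf design reg _ sz_es faith cardF T T').
(* Since [a^(21 k) = w^k], induction reduces invariance to a single multiplication by [w]. *)
move=> k U UC; rewrite exprM; elim: k => [|k IHk].
  by rewrite expr0 amull1 lim1g.
rewrite exprS amullM limg_comp.
apply: (span_set_invariant F chF P wf _ sz_es faith cardF T) => //.
- by move=> t tT; rewrite -(perm_mem permT) mem_cat tT.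
- apply/eqP=> w0; move: w2; rewrite /w w0 expr0n add0r => /esym/eqP.
  by rewrite oner_eq0.
- by move=> v szv; apply: decode_vomega; rewrite ?sz_bs.
Qed.
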